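(* Let $X$ be a consonant topological space. If for each $n\in\mathbb{N}$ the Scott topology on the $n$-fold product $\prod^n\mathcal{O}(X)$ coincides with the product topology of $n$ copies of $(\mathcal{O}(X),\sigma(\mathcal{O}(X)))$, then $P_H(X)$ is consonant.
   Context: $\mathcal{O}(X)$ is the complete lattice of open subsets of $X$ ordered by inclusion; products of posets carry the coordinatewise order. For a poset $Q$, the Scott topology $\sigma(Q)$ consists of the complements of those lower sets that are closed under existing suprema of directed subsets. $P_H(X)$, the lower powerspace of $X$, is the set $C(X)$ of all closed subsets of $X$ (including $\emptyset$) with the lower Vietoris topology, generated by the subbase of sets $\Diamond U=\{A\in C(X): A\cap U\neq\emptyset\}$, $U\in\mathcal{O}(X)$. For a space $Y$, $Q(Y)$ denotes the set of all compact saturated subsets of $Y$ (saturated: an intersection of open sets, i.e. an upper set in the specialization order; $\emptyset$ is included), and for $K\in Q(Y)$, $\Phi(K)=\{U\in\mathcal{O}(Y): K\subseteq U\}$. A space $Y$ is consonant if for every $\mathcal{H}\in\sigma(\mathcal{O}(Y))$ and every $U\in\mathcal{H}$ there exists $K\in Q(Y)$ such that $U\in\Phi(K)\subseteq\mathcal{H}$. *)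

(* Defs.v *)
From HB Require Import structures.
From mathcomp Require Import all_boot all_order all_classical.
From mathcomp Require Import topology_structure supremum_topology.
From mathcomp Require Import initial_topology compact function_spaces.

Set Implicit Arguments.
Unset Strict Implicit.
Unset Printing Implicit Defensive.

Import Order.TTheory.

Local Open Scope classical_set_scope.

(* [open] with its space explicit, to compare two topologies on one set. *)
Definition topology_of (T : topologicalType) : set (set T) := @open T.
Arguments topology_of T : clear implicits.

Section Scott.
Context {d : Order.disp_t} {Q : porderType d}.
Implicit Types (A D U : set Q) (s x y : Q).

(* Directed sets are nonempty, so the empty set is Scott-closed. *)
Definition directed D :=
  D !=set0 /\
  forall x y, D x -> D y -> exists z, [/\ D z, (x <= z)%O & (y <= z)%O].

Definition scott_closed A :=
  down A `<=` A /\
  forall D s, directed D -> D `<=` A -> isLub D s -> A s.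

Definition scott_open U := scott_closed (~` U).

Lemma scott_openT : scott_open setT.
Proof.
rewrite /scott_open setCT; split; first by move=> x [y []].
by move=> D s [[x Dx] _] DA _; exact: DA Dx.
Qed.

Lemma scott_openI : setI_closed scott_open.
Proof.
rewrite /scott_open => U V [dU sU] [dV sV]; rewrite setCI; split.
  move=> x [y [[yU|yV] xy]].
    by left; apply: dU; exists y.
  by right; apply: dV; exists y.
move=> D s [D0 dirD] DUV [ubs leasts].
have cofinal W : (forall x, D x -> exists z, [/\ D z, (x <= z)%O & W z]) ->
    directed (D `&` W) /\ isLub (D `&` W) s.
  move=> cofW; split.
    split.
      by case: D0 => x /cofW[z [Dz _ Wz]]; exists z.
    move=> x y [Dx _] [Dy _].
    have [z [Dz xz yz]] := dirD _ _ Dx Dy.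
    have [t [Dt zt Wt]] := cofW _ Dz.
    by exists t; split; [|exact: le_trans zt|exact: le_trans zt].
  split; first by move=> x [Dx _]; exact: ubs.
  move=> b ubb; apply: leasts => x /cofW[z [Dz xz Wz]].
  by apply: le_trans xz _; exact: ubb.
have [cofU|] := pselect
    (forall x, D x -> exists z, [/\ D z, (x <= z)%O & (~` U) z]).
  have [dirU lubU] := cofinal _ cofU.
  by left; apply: sU dirU _ lubU => x [].
move=> /existsNP[x /not_implyP[Dx nx]].
have cofV y : D y -> exists z, [/\ D z, (y <= z)%O & (~` V) z].
  move=> Dy; have [z [Dz xz yz]] := dirD _ _ Dx Dy.
  exists z; split=> //; have [nUz|//] := DUV _ Dz.
  by exfalso; apply: nx; exists z.
have [dirV lubV] := cofinal _ cofV.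
by right; apply: sV dirV _ lubV => y [].
Qed.

Lemma scott_open_bigU (I : Type) (f : I -> set Q) :
  (forall i, scott_open (f i)) -> scott_open (\bigcup_i f i).
Proof.
rewrite /scott_open => fo; rewrite setC_bigcup; split.
  move=> x [y [fy xy]] i _; have [df _] := fo i.
  by apply: df; exists y; split=> //; exact: fy.
move=> D s dirD Df lubs i _; have [_ sf] := fo i.
by apply: sf dirD _ lubs => x Dx; exact: Df.
Qed.

End Scott.

Definition scott (d : Order.disp_t) (Q : porderType d) : Type := Q.

HB.instance Definition _ (d : Order.disp_t) (Q : porderType d) :=
  Choice.on (scott Q).
HB.instance Definition _ (d : Order.disp_t) (Q : porderType d) :=
  isOpenTopological.Build (scott Q)
    scott_openT scott_openI (@scott_open_bigU d Q).

Definition opens (X : topologicalType) : Type := set_type (@open X).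

HB.instance Definition _ (X : topologicalType) := SubChoice.on (opens X).
HB.instance Definition _ (X : topologicalType) :=
  [SubChoice_isSubPOrder of opens X by <: with set_display].

Definition lower_powerspace (X : topologicalType) : Type :=
  set_type (@closed X).

HB.instance Definition _ (X : topologicalType) :=
  Choice.on (lower_powerspace X).

Definition diamond (X : topologicalType) (U : set X) :
    set (lower_powerspace X) :=
  [set A | val A `&` U !=set0].

HB.instance Definition _ (X : topologicalType) :=
  isSubBaseTopological.Build (lower_powerspace X) (@open X) (@diamond X).

Definition saturated (Y : topologicalType) (K : set Y) :=
  exists2 F : set (set Y), F `<=` open & K = \bigcap_(U in F) U.

Definition compact_saturated (Y : topologicalType) : set (set Y) :=
  [set K | compact K /\ saturated K].

Definition open_supersets (Y : topologicalType) (K : set Y) : set (opens Y) :=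
  [set U | K `<=` val U].

Definition consonant (Y : topologicalType) :=
  forall H : set (scott (opens Y)), open H -> forall U : opens Y, H U ->
  exists K : set Y,
    [/\ compact_saturated K, open_supersets K U & open_supersets K `<=` H].

(* Main.v *)
Require Import Defs.
From mathcomp Require Import all_boot all_order all_classical.
From mathcomp Require Import topology_structure function_spaces.
From mathcomp Require Import supremum_topology initial_topology compact.
From mathcomp Require Import finmap.

(** Write [H] for a Scott-open set of open sets of the lower powerspace, and
    [W] for a member of [H].  The basic open sets are finite intersections of
    diamonds, and [W] is the directed union of the finite unions of basic open
    sets below it, so [H] already contains one of those, [hit_formula f l]:
    the closed sets that hit all of [f j], [j \in t], for some [t] in the
    finite list [l] ([scott_open_has_formula]).

    Now let the finitely many open sets [f j] of [X] vary.  Diamonds preserve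
    unions, and finite meets and joins preserve directed unions, so
    [f |-> hit_formula f l] is Scott continuous on the finite power of the
    lattice of open sets ([scott_open_formula_preimage]).  The hypothesis on
    Scott topologies makes the preimage of [H] open in the product topology:
    it contains a box of Scott-open sets [V j] around [f].  Consonance of [X]
    puts a compact [K j] between [f j] and [V j], that is, [K j] lies in [f j]
    and every open set around [K j] belongs to [V j].

    The compact set required for [W] is [hit_formula K l].  It is an upper
    set, hence saturated.  Its other two properties are the analogues, for
    formulas, of the finite Tychonoff theorem and of the tube lemma: it is
    compact, and every open set around it contains some [hit_formula U l] with
    [U j] open around [K j].  Such a [hit_formula U l] is in [H] by the choice
    of the box, so every open set around [hit_formula K l] is in [H].

    Both facts come from one local-to-global principle
    ([hit_formula_ideal]): an ideal of sets of closed sets that contains a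
    neighbourhood of each point of [hit_formula K l] contains a whole
    [hit_formula U l].  It is proved by treating one compact set at a time,
    using that compactness says exactly that ideals are local on the set
    ([compact_idealP]). *)

Set Implicit Arguments.
Unset Strict Implicit.
Unset Printing Implicit Defensive.

Import Order.TTheory.

Local Open Scope classical_set_scope.

(** * Scott-open sets *)

Section ScottOpen.
Context {d : Order.disp_t} {Q : porderType d}.
Implicit Types (D H : set Q) (x y s : Q).

Lemma scott_open_up H x y : scott_open H -> (x <= y)%O -> H x -> H y.
Proof.
move=> [dH _] xy Hx; apply: contrapT => nHy.
by apply: (dH x) Hx; exists y.
Qed.

Lemma scott_open_lub H D s : scott_open H -> directed D -> isLub D s -> H s ->
  exists2 x, D x & H x.
Proof.
move=> [_ sH] dirD lubs Hs; apply: contrapT => nex.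
apply: sH dirD _ lubs Hs => x Dx Hx.
by apply: nex; exists x.
Qed.

Lemma directed_seq D (xs : seq Q) : directed D -> {subset xs <= D} ->
  exists2 z, D z & forall x, x \in xs -> (x <= z)%O.
Proof.
move=> [[z0 Dz0] dirD]; elim: xs => [|x xs IH] sD; first by exists z0.
have [|z Dz zxs] := IH; first by move=> y yxs; apply: sD; rewrite inE yxs orbT.
have /set_mem Dx : x \in D by apply: sD; rewrite mem_head.
have [t [Dt xt zt]] := dirD _ _ Dx Dz.
exists t => // y; rewrite inE => /predU1P[->//|/zxs yz].
exact: le_trans yz zt.
Qed.

End ScottOpen.

Lemma scott_open_preimage d d' (Q : porderType d) (R : porderType d')
    (g : Q -> R) (H : set R) :
  {homo g : x y / (x <= y)%O} ->
  (forall D s, directed D -> isLub D s -> isLub (g @` D) (g s)) ->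
  scott_open H -> scott_open (g @^-1` H).
Proof.
move=> gmono glub oH; split.
  by move=> x [y [nHy xy]] Hx; apply: nHy; exact: scott_open_up (gmono _ _ xy) Hx.
move=> D s dirD DH lubs Hs.
have dirg : directed (g @` D).
  have [[x Dx] dD] := dirD; split; first by exists (g x); exists x.
  move=> _ _ [y Dy <-] [z Dz <-]; have [t [Dt yt zt]] := dD _ _ Dy Dz.
  by exists (g t); split; [exists t|exact: gmono|exact: gmono].
have [_ [x Dx <-] Hx] := scott_open_lub oH dirg (glub _ _ dirD lubs) Hs.
exact: DH Dx Hx.
Qed.

(** * Open sets and their suprema *)

Section Opens.
Context {X : topologicalType}.
Implicit Types (U V : opens X) (D : set (opens X)).

Definition opens_of (A : set X) (oA : open A) : opens X :=
  exist _ A (mem_set oA).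

Lemma opens_open U : open (val U).
Proof. exact: set_mem (valP U). Qed.

Lemma opens_leP U V : (U <= V)%O <-> val U `<=` val V.
Proof. by rewrite leEsub subsetEset. Qed.

Lemma opens_isLub D U : (forall V, D V -> (V <= U)%O) ->
  (forall x, val U x -> exists2 V, D V & val V x) -> isLub D U.
Proof.
move=> ubU covU; split=> // W ubW; apply/opens_leP => x /covU[V DV Vx].
by move/ubW: DV => /opens_leP; apply.
Qed.

End Opens.

(** The coordinatewise union of [D] is an upper bound of [D] in the power, so
    it lies above the supremum. *)
Lemma opens_power_lub (X : topologicalType) n (D : set ('I_n -> opens X)) s i x :
  isLub D s -> val (s i) x -> exists2 f, D f & val (f i) x.
Proof.
move=> [ubs leasts] six.
have oU j : open (\bigcup_(f in D) val (f j)).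
  by apply: bigcup_open => f _; exact: opens_open.
have : (s <= (fun j => opens_of (oU j)))%O.
  apply: leasts => f Df; apply/lefP => j; apply/opens_leP => y fjy.
  by exists f.
by move=> /lefP/(_ i)/opens_leP/(_ _ six)[f Df fix_]; exists f.
Qed.

(** * Boxes in finite powers *)

(** With [P := i = j] this makes families of open sets that constrain a single
    coordinate, without a decidable equality on the indices. *)
Lemma open_imply (T : topologicalType) (P : Prop) (U : set T) :
  open U -> open [set x | P -> U x].
Proof.
move=> oU; have [p|np] := pselect P.
  by rewrite (_ : mkset _ = U) //; apply/seteqP; split=> x /= Ux; [exact: Ux|].
rewrite (_ : mkset _ = setT); first exact: openT.
by apply/seteqP; split=> x /= _ => [|/np].
Qed.

(** The sets that contain an open box around [f] form a filter, and it
    converges to [f] because it does so in each coordinate; so it contains every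
    neighbourhood of [f]. *)
Lemma open_ptws_box (T : topologicalType) n (O : set {ptws 'I_n -> T}) f :
  open O -> O f -> exists V : 'I_n -> set T,
    [/\ forall i, open (V i), forall i, V i (f i) &
        forall g, (forall i, V i (g i)) -> O g].
Proof.
move=> oO Of.
pose F : set_system ('I_n -> T) := [set S | exists V : 'I_n -> set T,
  [/\ forall i, open (V i), forall i, V i (f i) &
      forall g, (forall i, V i (g i)) -> S g]].
have FF : Filter F.
  split.
  - by exists (fun=> setT); split=> // i; exact: openT.
  - move=> A B [V [oV Vf VA]] [W [oW Wf WB]].
    exists (fun i => V i `&` W i); split=> [i|i|g VWg]; first exact: openI.
      by split.
    by split; [apply: VA|apply: WB] => i; have [] := VWg i.
  - move=> A B AB [V [oV Vf VA]]; exists V; split=> // g Vg.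
    by apply: AB; exact: VA.
have cvF : F --> (f : {ptws 'I_n -> T}).
  apply/cvg_sup => i A; rewrite nbhsE /= => -[B [[C oC CB] Bf] BA].
  exists (fun j => [set y | j = i -> C y]); split.
  - by move=> j; exact: open_imply.
  - by move=> j /= ->; move: Bf; rewrite -CB.
  - by move=> g /(_ i) /= Cg; apply: BA; rewrite -CB; exact: Cg.
by apply: cvF; exact: open_nbhs_nbhs.
Qed.

(** * Compactness through ideals *)

Definition ideal (T : Type) (P : set (set T)) :=
  [/\ P set0, forall A B, A `<=` B -> P B -> P A & setU_closed P].

(** Compactness as a local-to-global principle.  Ideals are dual to filters: an
    ideal [P] without [K] gives the proper filter of the sets whose complement
    in [K] is in [P], and a cluster point of it in [K] has no neighbourhood in
    [P]. *)
Lemma compact_idealP (T : topologicalType) (K : set T) :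
  compact K <-> forall P, ideal P ->
    (forall x, K x -> exists2 U, nbhs x U & P U) -> P K.
Proof.
split=> [cK P [P0 PS PU] locP|idK F FF FK].
  apply: contrapT => nPK.
  have FF : ProperFilter [set S | P (K `\` S)].
    split; first by rewrite /= setD0.
    split=> [|A B /= PA PB|A B AB /=]; first by rewrite /= setDT.
      by rewrite setDIr; exact: PU.
    by apply: PS => x [Kx nBx]; split=> // /AB.
  have [|x [Kx clx]] := cK _ FF; first by rewrite /= setDv.
  have [U xU PU'] := locP _ Kx.
  have [|y []//] := clx (~` U) U _ xU.
  by apply: PS PU' => y [_ /contrapT].
apply: contrapT => ncl.
have : F (~` K).
  apply: (idK [set S | F (~` S)]) => [|x Kx].
    split=> [|A B AB|A B FA FB] /=; first by rewrite setC0; exact: filterT.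
      by apply: filterS; exact: subsetC.
    by rewrite setCU; exact: filterI.
  apply: contrapT => nU; apply: ncl; exists x; split=> // A B FA xB.
  apply: contrapT => nAB; apply: nU; exists B => //=.
  by apply: filterS FA => y Ay By; apply: nAB; exists y.
move=> FnK; apply: (filter_not_empty F).
by rewrite -(setICr K); exact: filterI.
Qed.

(** * Hitting formulas on the lower powerspace *)

Section LowerPowerspace.
Context {X : topologicalType}.
Implicit Types (A : lower_powerspace X) (U : set X).

Definition hits A U : bool := `[< val A `&` U !=set0 >].

(** With the open sets [f j], these are the basic open sets of the subbase of
    diamonds; the same expression makes sense for the compact sets [K j]. *)
Definition hits_all (J : Type) (f : J -> set X) (t : seq J) :
    set (lower_powerspace X) :=
  [set A | all (fun j => hits A (f j)) t].

(** A positive formula in disjunctive normal form, whose atom [j] says that the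
    closed set meets [f j]. *)
Definition hit_formula (J : Type) (f : J -> set X) (l : seq (seq J)) :
    set (lower_powerspace X) :=
  [set A | has (all (fun j => hits A (f j))) l].

Lemma hitsS A A' U U' : val A `<=` val A' -> U `<=` U' ->
  hits A U -> hits A' U'.
Proof.
move=> AA' UU' /asboolP[x [Ax Ux]]; apply/asboolP.
by exists x; split; [exact: AA'|exact: UU'].
Qed.

Lemma hit_formulaS (J : Type) (f g : J -> set X) l A A' :
  val A `<=` val A' -> (forall j, f j `<=` g j) ->
  hit_formula f l A -> hit_formula g l A'.
Proof.
by move=> AA' fg; apply: sub_has => t; apply: sub_all => j; exact: hitsS.
Qed.

Lemma open_diamond U : open U -> open (diamond U).
Proof.
move=> oU; exists [set diamond U]; last by rewrite bigcup_set1.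
move=> _ ->; exists (fset1 U).
  by move=> V; rewrite inE => /eqP->; exact/mem_set.
apply/seteqP; split=> [A /(_ U) /= |A AU V /=]; first by rewrite inE; apply.
by rewrite inE => /eqP->.
Qed.

Lemma open_hits_all (J : Type) (f : J -> set X) t :
  (forall j, open (f j)) -> open (hits_all f t).
Proof.
move=> of_; elim: t => [|j t IH].
  by rewrite (_ : hits_all f [::] = setT); [exact: openT|apply/seteqP; split].
rewrite (_ : hits_all f (j :: t) = diamond (f j) `&` hits_all f t).
  by apply: openI => //; exact: open_diamond.
apply/seteqP; split=> A /=; rewrite /hits_all /=.
  by move=> /andP[/asboolP].
by move=> [? ->]; rewrite andbT; exact/asboolP.
Qed.

Lemma open_hit_formula (J : Type) (f : J -> set X) l :
  (forall j, open (f j)) -> open (hit_formula f l).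
Proof.
move=> of_; elim: l => [|t l IH].
  by rewrite (_ : hit_formula f [::] = set0); [exact: open0|apply/seteqP; split].
rewrite (_ : hit_formula f (t :: l) = hits_all f t `|` hit_formula f l).
  by apply: openU => //; exact: open_hits_all.
apply/seteqP; split=> A; rewrite /hit_formula /hits_all /=.
  by move=> /orP.
by move=> H; apply/orP.
Qed.

Lemma lower_basis (B : set (lower_powerspace X)) A : open B -> B A ->
  exists t : seq (opens X), hits_all val t A /\ hits_all val t `<=` B.
Proof.
move=> [C sC <-] [S CS]; have [E oE ES] := sC _ CS; rewrite -{1}ES => EA.
exists (pmap insub (enum_fset E)); split.
  apply/allP => U; rewrite mem_pmap_sub => UE.
  by apply/asboolP; exact: (EA (val U)).
move=> A' /allP tA'; exists S => //; rewrite -ES.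
move=> U /= UE; have /set_mem oU : U \in @open X by exact: oE.
apply/asboolP; apply: (tA' (opens_of oU)).
by rewrite mem_pmap_sub.
Qed.

Lemma lower_open_up (B : set (lower_powerspace X)) A A' :
  open B -> val A `<=` val A' -> B A -> B A'.
Proof.
move=> oB AA' /(lower_basis oB)[t [tA tB]]; apply: tB.
by move: tA; apply: sub_all => U; exact: hitsS.
Qed.

(** A closed set [A] outside the formula is excluded by the diamond of the
    complement of [A]: a closed set that misses this complement is included in
    [A], and satisfying the formula is inherited by larger closed sets. *)
Lemma saturated_hit_formula (J : Type) (f : J -> set X) l :
  saturated (hit_formula f l).
Proof.
exists [set B | open B /\ hit_formula f l `<=` B]; first by move=> B [].
apply/seteqP; split=> [A fA B [_]|A bigA]; first exact.
apply: contrapT => nfA.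
have [] : (diamond (~` val A)) A.
  apply: bigA; split=> [|A' fA'].
    by apply: open_diamond; rewrite openC; exact: set_mem (valP A).
  apply: contrapT => dA'; apply: nfA.
  apply: (hit_formulaS _ (fun _ _ fx => fx) fA') => x A'x.
  by apply: contrapT => nAx; apply: dA'; exists x.
by move=> ? [].
Qed.

Definition closed_of (C : set X) (cC : closed C) : lower_powerspace X :=
  exist _ C (mem_set cC).

Definition lower_join A (x : X) : lower_powerspace X :=
  closed_of (closedU (set_mem (valP A)) (@closed_closure X [set x])).

Lemma hits_join A x U : open U ->
  hits (lower_join A x) U = hits A U || (x \in U).
Proof.
move=> oU; apply/asboolP/orP.
  move=> [y [[Ay|clx] Uy]]; first by left; apply/asboolP; exists y.
  right; have [|z [-> Ux]] := clx U; first exact: open_nbhs_nbhs.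
  exact/mem_set.
move=> [/asboolP[y [Ay Uy]]|/set_mem Ux]; first by exists y; split=> //; left.
by exists x; split=> //; right; exact: subset_closure.
Qed.

(** Joint continuity of [lower_join]: an open condition on the join of [A] and
    the point [x] can be met by an open condition on [A] together with hitting a
    neighbourhood of [x].  For a basic condition, each diamond that holds of the
    join holds because of [A] or because of [x]. *)
Lemma lower_join_open (B : set (lower_powerspace X)) A x :
  open B -> B (lower_join A x) ->
  exists B' U, [/\ open B', B' A, open U, U x &
    forall A', B' A' -> hits A' U -> B A'].
Proof.
move=> oB /(lower_basis oB)[t [tAx tB]].
exists (hits_all val [seq U <- t | hits A (val U)]).
exists (\bigcap_(U in [set` [seq U <- t | x \in val U]]) val U); split.
- by apply: open_hits_all => U; exact: opens_open.
- by apply/allP => U; rewrite mem_filter => /andP[].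
- rewrite bigcap_seq; apply: big_ind => [|U V|U _]; first exact: openT.
    exact: openI.
  exact: opens_open.
- by move=> U /=; rewrite mem_filter => /andP[/set_mem].
move=> A' /allP B'A' A'U; apply: tB; apply/allP => U tU.
have := allP tAx _ tU; rewrite hits_join; last exact: opens_open.
case/orP=> [AU|xU]; first by apply: B'A'; rewrite mem_filter AU.
by apply: hitsS A'U => // y; apply; rewrite /= mem_filter xU.
Qed.

(** Induction on [t].  The closed set [A0] collects points already chosen in the
    compact sets treated so far; only an open neighbourhood [B] of it is kept.
    For the next index [j], adding a point [x] of [K j] to [A0] gives by
    induction a neighbourhood of the join, which [lower_join_open] splits into
    a neighbourhood of [A0] and a neighbourhood [U] of [x].  The sets [S] for
    which some open [U] containing [S] works form an ideal, so compactness of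
    [K j] provides one [U] for all of [K j]. *)
Lemma hits_all_ideal (J : Type) (K : J -> set X)
    (P : set (set (lower_powerspace X))) :
  (forall j, compact (K j)) -> ideal P -> forall t A0,
  (forall A, val A0 `<=` val A -> hits_all K t A -> exists2 N, nbhs A N & P N) ->
  exists B (V : J -> set X), [/\ open B, B A0, forall j, open (V j),
    forall j, K j `<=` V j & P (B `&` hits_all V t)].
Proof.
move=> cK idP; have [P0 PS PU] := idP; elim=> [|j t IH] A0 locP.
  have [//|//|N] := locP A0; rewrite nbhsE => -[B [oB BA0] BN PN].
  exists B, (fun=> setT); split=> //; first by move=> _; exact: openT.
  by apply: PS PN => A [/BN].
pose I : set (set X) := [set S | exists U B (V : J -> set X),
  [/\ open U, S `<=` U, open B /\ B A0, forall i, open (V i) /\ K i `<=` V i &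
      P (B `&` diamond U `&` hits_all V t)]].
have idI : ideal I.
  split.
  - exists set0, setT, (fun=> setT); split=> //; first exact: open0.
    + by split=> //; exact: openT.
    + by split=> //; exact: openT.
    + by apply: PS P0 => A [[_ [x []]]].
  - by move=> S S' SS' [U [B [V [oU /(subset_trans SS') SU BA0 KV PB]]]];
      exists U, B, V; split.
  - move=> S S' [U [B [V [oU SU [oB BA0] KV PB]]]].
    move=> [U' [B' [V' [oU' SU' [oB' BA0'] KV' PB']]]].
    exists (U `|` U'), (B `&` B'), (fun i => V i `&` V' i); split.
    + exact: openU.
    + exact: setUSS.
    + by split; [exact: openI|split].
    + move=> i; have [oV KVi] := KV i; have [oV' KVi'] := KV' i.
      by split; [exact: openI|move=> x Kx; split; [exact: KVi|exact: KVi']].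
    apply: PS (PU _ _ PB PB') => A [[[BA B'A] [x [Ax Ux]]] VA].
    case: Ux => Ux; [left|right]; (split; first by split=> //; exists x);
      by move: VA; apply: sub_all => i; apply: hitsS => // y [].
have [|U [B [V [oU KU [oB BA0] KV PB]]]] :=
    (iffLR (compact_idealP (K j)) (cK j)) I idI.
  move=> x Kjx; have [|B [V [oB BA oV KV PB]]] := IH (lower_join A0 x).
    move=> A joinA tA; apply: locP => [y A0y|].
      by apply: joinA; left.
    rewrite /hits_all /= tA andbT; apply/asboolP; exists x; split=> //.
    by apply: joinA; right; exact: subset_closure.
  have [B' [U [oB' B'A0 oU Ux UB]]] := lower_join_open oB BA.
  exists U; first exact: open_nbhs_nbhs.
  exists U, B', V; split=> //.
  by apply: PS PB => A [[B'A UA] tA]; split=> //; apply: UB => //; apply/asboolP.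
(* The index [j] may occur again in [t], so [U] is intersected with the former
   [V j] instead of replacing it. *)
exists B, (fun i => V i `&` [set x | i = j -> U x]); split=> //.
- move=> i; apply: openI; first by have [] := KV i.
  exact: open_imply.
- move=> i x Kx; split; first by have [_] := KV i; exact.
  by move=> /= ij; apply: KU; rewrite -ij.
apply: PS PB => A [BA /= /andP[/asboolP[x [Ax [_ Ux]]] tA]].
split; first by split=> //; exists x; split=> //; exact: Ux.
by move: tA; apply: sub_all => i; apply: hitsS => // y [].
Qed.

(** The disjuncts are treated separately and the resulting open sets
    intersected.  Each disjunct starts [hits_all_ideal] from the empty closed
    set, whose only open neighbourhood is the whole space since open sets are
    upper sets. *)
Lemma hit_formula_ideal (J : Type) (K : J -> set X)
    (P : set (set (lower_powerspace X))) l :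
  (forall j, compact (K j)) -> ideal P ->
  (forall A, hit_formula K l A -> exists2 N, nbhs A N & P N) ->
  exists V : J -> set X, [/\ forall j, open (V j), forall j, K j `<=` V j &
    P (hit_formula V l)].
Proof.
move=> cK idP; have [P0 PS PU] := idP; elim: l => [|t l IH] locP.
  exists (fun=> setT); split=> //; first by move=> _; exact: openT.
  by apply: PS P0.
have [|W [oW KW PW]] := IH.
  by move=> A lA; apply: locP; apply/orP; right.
have := @hits_all_ideal _ _ _ cK idP t (closed_of (@closed0 X)).
case=> [A _ tA|B [V [oB B0 oV KV PV]]].
  by apply: locP; apply/orP; left.
exists (fun j => V j `&` W j); split=> [j|j x Kx|].
- exact: openI.
- by split; [exact: KV|exact: KW].
apply: PS (PU _ _ PV PW) => A /= /orP[tA|lA]; [left|right].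
  split; first exact: lower_open_up B0.
  by move: tA; apply: sub_all => i; apply: hitsS => // y [].
by apply: hit_formulaS lA => // j y [].
Qed.

(** The finite Tychonoff theorem for formulas. *)
Lemma compact_hit_formula (J : Type) (K : J -> set X) l :
  (forall j, compact (K j)) -> compact (hit_formula K l).
Proof.
move=> cK; apply/compact_idealP => P idP /(hit_formula_ideal cK idP)[V [_ KV]].
by have [_ PS _] := idP; apply: PS => A; exact: hit_formulaS.
Qed.

(** The tube lemma for formulas: apply the principle to the ideal of the subsets
    of [W]. *)
Lemma hit_formula_tube (J : Type) (K : J -> set X) l
    (W : set (lower_powerspace X)) :
  (forall j, compact (K j)) -> open W -> hit_formula K l `<=` W ->
  exists V : J -> set X, [/\ forall j, open (V j), forall j, K j `<=` V j &
    hit_formula V l `<=` W].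
Proof.
move=> cK oW KW; apply: (hit_formula_ideal (P := [set S | S `<=` W])) => //.
  split=> [|A B AB BW|A B AW BW] /=; first exact: sub0set.
    exact: subset_trans BW.
  by rewrite subUset.
by move=> A /KW WA; exists W => //; exact: open_nbhs_nbhs.
Qed.

(** * Formulas and Scott-open sets *)

Definition open_formula (J : Type) (l : seq (seq J)) (f : J -> opens X) :
    opens (lower_powerspace X) :=
  opens_of (open_hit_formula l (fun j => opens_open (f j))).

(** A closed set that satisfies the formula at a directed supremum [s] hits
    finitely many [s j]; each of these hits happens at some member of the
    directed set, and one member bounds them all. *)
Lemma scott_open_formula_preimage n (l : seq (seq 'I_n))
    (H : set (opens (lower_powerspace X))) :
  scott_open H -> scott_open (open_formula l @^-1` H).
Proof.
have mono : {homo @open_formula 'I_n l : f g / (f <= g)%O}.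
  move=> f g /lefP fg; apply/opens_leP => A; apply: hit_formulaS => // j.
  exact/opens_leP.
apply: scott_open_preimage => // D s dirD lubs.
apply: opens_isLub => [_ [f Df <-]|A sA].
  by apply: mono; have [ub _] := lubs; exact: ub.
have meet j : exists2 f, D f &
    (hits A (val (s j)) -> hits A (val (f j))).
  have [/asboolP[x [Ax sx]]|nh] := boolP (hits A (val (s j))).
    have [f Df fx] := opens_power_lub lubs sx.
    by exists f => // _; apply/asboolP; exists x.
  by have [[f Df] _] := dirD; exists f.
(* Each [F j] is itself a family of open sets, of which the entry at [j] is the
   one that matters: hence the diagonal [F j j]. *)
have [F FD Fs] : exists2 F : 'I_n -> 'I_n -> opens X, forall j, D (F j) &
    forall j, hits A (val (s j)) -> hits A (val (F j j)).
  have [F FP] := choice (fun j => iffLR (exists2P _ _) (meet j)).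
  by exists F => j; have [] := FP j.
have [|z Dz Fz] := directed_seq (xs := codom F) dirD.
  by move=> _ /codomP[j ->]; exact/mem_set.
exists (open_formula l z); first by exists z.
move: sA; apply: sub_has => t; apply: sub_all => j /Fs; apply: hitsS => //.
by have /lefP/(_ j)/opens_leP := Fz _ (codom_f F j).
Qed.

(** The formulas below [W] are directed, as disjunctions of formulas are
    formulas, and they cover [W], as basic open sets are formulas. *)
Lemma scott_open_has_formula (H : set (opens (lower_powerspace X)))
    (W : opens (lower_powerspace X)) :
  scott_open H -> H W -> exists l : seq (seq (opens X)),
    H (open_formula l id) /\ (open_formula l id <= W)%O.
Proof.
move=> oH HW.
pose D := [set Z | (Z <= W)%O /\ exists l, Z = open_formula l id].
suff [Z [ZW [l Zl]] HZ] : exists2 Z, D Z & H Z by exists l; rewrite -Zl.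
apply: scott_open_lub (oH) _ _ HW.
  split.
    exists (open_formula [::] id); split; last by exists [::].
    by apply/opens_leP.
  move=> _ _ [/[swap] [[l1 ->]] /opens_leP W1] [/[swap] [[l2 ->]] /opens_leP W2].
  exists (open_formula (l1 ++ l2) id); split.
  - split; last by exists (l1 ++ l2).
    by apply/opens_leP => A /=; rewrite /hit_formula /= has_cat => /orP[/W1|/W2].
  - apply/opens_leP => A /= l1A; rewrite /hit_formula /= has_cat.
    by apply/orP; left.
  - apply/opens_leP => A /= l2A; rewrite /hit_formula /= has_cat.
    by apply/orP; right.
apply: opens_isLub => [Z []//|A WA].
have [t [tA tW]] := lower_basis (opens_open W) WA.
have fE : hit_formula val [:: t] = hits_all val t.
  by apply/seteqP; split=> A' /=; rewrite /hit_formula /hits_all /= orbF.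
exists (open_formula [:: t] id); last by rewrite /= fE.
split; last by exists [:: t].
by apply/opens_leP; rewrite /= fE.
Qed.

End LowerPowerspace.

(** Only finitely many entries occur in [l]; the index one past the end carries
    the default value, so that there is always an index. *)
Lemma reindex_ord (T : eqType) (x0 : T) (l : seq (seq T)) :
  exists n (f : 'I_n -> T) (l' : seq (seq 'I_n)), l = map (map f) l'.
Proof.
pose e := flatten l.
exists (size e).+1, (fun i => nth x0 e i).
exists (map (map (fun x => inord (index x e))) l).
rewrite -map_comp -[LHS]map_id; apply/eq_in_map => t tl /=.
rewrite -map_comp -[LHS]map_id; apply/eq_in_map => x xt /=.
have xe : x \in e by apply/flattenP; exists t.
by rewrite inordK ?nth_index // ltnS index_size.
Qed.

Theorem theorem5p2 (X : topologicalType)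
  (consonantX : consonant X)
  (scott_prodX : forall n : nat,
    topology_of (scott ('I_n -> opens X)) =
    topology_of {ptws 'I_n -> scott (opens X)}) :
  consonant (lower_powerspace X).
Proof.
move=> H oH W HW.
have [l0 [Hl0 l0W]] := scott_open_has_formula oH HW.
have [n [f [l l0E]]] := reindex_ord (opens_of (@open0 X)) l0.
have formulaE (g : opens X -> set X) : hit_formula g l0 = hit_formula (g \o f) l.
  apply/seteqP; split=> A; rewrite /hit_formula /= l0E has_map;
  by apply: sub_has => t /=; rewrite all_map.
have Hf : H (open_formula l f).
  apply: scott_open_up oH _ Hl0; apply/opens_leP => A /=.
  by rewrite (formulaE val).
have fW : hit_formula (val \o f) l `<=` val W.
  by rewrite -formulaE; have /opens_leP := l0W.
have oP : topology_of {ptws 'I_n -> scott (opens X)} (open_formula l @^-1` H).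
  by rewrite -scott_prodX; exact: scott_open_formula_preimage.
have [V [oV Vf VH]] := open_ptws_box oP Hf.
have [K KP] := choice (fun i => consonantX (V i) (oV i) (f i) (Vf i)).
have cK i : compact (K i) by have [[]] := KP i.
exists (hit_formula K l); split.
- by split; [exact: compact_hit_formula|exact: saturated_hit_formula].
- apply: subset_trans fW => A; apply: hit_formulaS => // i.
  by have [_] := KP i.
move=> Z KZ; have [U [oU KU UZ]] := hit_formula_tube cK (opens_open Z) KZ.
apply: (scott_open_up (x := open_formula l (fun i => opens_of (oU i)))) oH _ _.
  exact/opens_leP.
by apply: VH => i; have [_ _] := KP i; apply; exact: KU.
Qed.
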